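(* Let $d\ge1$ be a fixed integer and let $\mathbb W$ be an $n_1\times n_2$ window (with $n_1\le n_2$) of area $A=n_1n_2$ and thickness bounded by a constant. Then, provided $A$ is large enough, there is a binary robust positioning array of strength $n_1\times n_2$ and distance $d$ whose redundancy is at most $$4.21\,d\log_2A+36.89\log_2A+o(1),$$ where $o(1)$ denotes a quantity tending to $0$ as $A\to\infty$ (with $d$ fixed).
   Context: For an $n_1\times n_2$ window with $n_1\le n_2$, its area is $n_1n_2$ and its thickness is $(\log n_1)/(\log n_2)$. A binary array of dimension $N_1\times N_2$ is a robust positioning array of strength $n_1\times n_2$ and distance $d$ (an $(n_1\times n_2,d)$-RPA) if any two of its contiguous $n_1\times n_2$ subarrays with distinct top-left positions $(i,j),(i',j')$, where $0\le i,i'\le N_1-n_1$ and $0\le j,j'\le N_2-n_2$, have Hamming distance at least $d$. Its redundancy is $n_1n_2-\log_2(N_1N_2)$. *)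

(* Defs.v *)
From mathcomp Require Import all_boot all_order all_algebra.
From mathcomp Require Import all_classical all_reals all_analysis.

Set Implicit Arguments.
Unset Strict Implicit.
Unset Printing Implicit Defensive.

Import Order.TTheory GRing.Theory Num.Theory.
Import numFieldNormedType.Exports.
Local Open Scope ring_scope.

Definition hamming_dist (T : eqType) (m n : nat) (P Q : 'M[T]_(m, n)) : nat :=
  #|[set ab : 'I_m * 'I_n | P ab.1 ab.2 != Q ab.1 ab.2]|.

(* Entry (a, b) of [subarray M hi hj] is entry (i + a, j + b) of [M]; the proofs
   [hi] and [hj] say exactly that i <= N1 - n1 and j <= N2 - n2. *)
Definition subarray (T : Type) (N1 N2 n1 n2 i j : nat) (M : 'M[T]_(N1, N2))
    (hi : (i + n1 <= N1)%N) (hj : (j + n2 <= N2)%N) : 'M[T]_(n1, n2) :=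
  mxsub (fun a : 'I_n1 => widen_ord hi (rshift i a))
        (fun b : 'I_n2 => widen_ord hj (rshift j b)) M.

(* The window is required to fit in the array: otherwise there is no position
   at all, and every array, however large, would vacuously qualify. *)
Definition robust_positioning_array (T : eqType) (N1 N2 n1 n2 d : nat)
    (M : 'M[T]_(N1, N2)) : Prop :=
  [/\ (n1 <= N1)%N, (n2 <= N2)%N &
    forall (i j i' j' : nat)
      (hi : (i + n1 <= N1)%N) (hj : (j + n2 <= N2)%N)
      (hi' : (i' + n1 <= N1)%N) (hj' : (j' + n2 <= N2)%N),
      (i, j) <> (i', j') ->
      (d <= hamming_dist (subarray M hi hj) (subarray M hi' hj'))%N].

Definition log2 (R : realType) (x : R) : R := ln x / ln 2.

Definition redundancy (R : realType) (n1 n2 N1 N2 : nat) : R :=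
  (n1 * n2)%:R - log2 (N1 * N2)%:R.

Definition thickness (R : realType) (n1 n2 : nat) : R :=
  ln n1%:R / ln n2%:R.

(* Main.v *)
Require Import Defs.
From mathcomp Require Import all_boot all_order all_algebra.
From mathcomp Require Import all_classical all_reals all_analysis.
From mathcomp Require Import zify lra.

Set Implicit Arguments.
Unset Strict Implicit.
Unset Printing Implicit Defensive.

Import Order.TTheory GRing.Theory Num.Theory.
Import numFieldNormedType.Exports.
Local Open Scope classical_set_scope.
Local Open Scope ring_scope.

(** Taking N1 = n1 and reading the array column by column, it suffices to find
    a long binary word any two of whose windows of length A = n1 * n2 are at
    distance at least d.  Such words are counted by Rosenfeld's method: let T n
    be their number at length n.  If appending a bit to a good word of length n
    creates a bad pair of windows, then the last A bits are determined by the
    first m = n + 1 - A bits, the position of the earlier window and the error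
    pattern, even when the two windows overlap.  Hence
    T (n + 1) >= 2 T n - m V T m with V <= (A + 1)^d, and by induction
    T (n + 1) >= (2 - 1/A) T n for n < L as long as 4 L A (A + 1)^d <= 2^A.  The
    largest such L gives redundancy at most (2 d + 4) log2 A. *)

Local Open Scope nat_scope.

(** * Powers against exponentials *)

Lemma leq_exp2rW m n e : m <= n -> m ^ e <= n ^ e.
Proof. by case: e => // e mn; rewrite leq_exp2r. Qed.

(** With [j] the integer part of log2 [n], it suffices that [j.+1 * k <= 2 ^ j], the product of
    [j.+1 <= 2 ^ (j - k)] and [k <= 2 ^ k]. *)
Lemma exp_le_exp2 k n : 2 ^ k.*2.+1 <= n -> n ^ k <= 2 ^ n.
Proof.
move=> kn; have n_gt0 : 0 < n by apply: leq_trans kn; rewrite expn_gt0.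
have [jn nj] := andP (trunc_log_bounds (leqnn 2) n_gt0).
set j := trunc_log 2 n in jn nj.
have kj : k.*2.+1 <= j by rewrite -ltnS -(ltn_exp2l _ _ (leqnn 2)) (leq_ltn_trans kn).
apply: (@leq_trans (2 ^ (j.+1 * k))); first by rewrite expnM leq_exp2rW // ltnW.
rewrite leq_exp2l //; apply: leq_trans jn.
have -> : j = (j - k).-1.+1 + k by lia.
rewrite expnD leq_mul ?(ltnW (ltn_expl _ _)) //.
rewrite expnS; have := @ltn_expl 2 (j - k).-1 isT; lia.
Qed.

(** * Difference patterns and their decoding *)

Section Words.

Implicit Types (w p e : seq bool).

Fixpoint diff_pattern w i j n : seq bool :=
  if n is n'.+1 then
    (nth false w i (+) nth false w j) :: diff_pattern w i.+1 j.+1 n'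
  else [::].

Lemma diff_patternE w i j n :
  diff_pattern w i j n =
  mkseq (fun t => nth false w (i + t) (+) nth false w (j + t)) n.
Proof.
elim: n i j => //= n IHn i j; rewrite IHn /mkseq /= !addn0; congr cons.
by rewrite -[in RHS]add1n iotaDl -map_comp; apply: eq_map => t /=; rewrite !addnA !addn1.
Qed.

(* Each appended bit reads [p] at the moving index [i], which may run into the
   part already appended: this handles overlapping windows. *)
Fixpoint extend_by i e p : seq bool :=
  if e is b :: e' then extend_by i.+1 e' (rcons p (nth false p i (+) b)) else p.

(** Bit [j + t] of [w] is bit [i + t] xor error [t]; as [i < j], bit [i + t] is already present when
    it is read. *)
Lemma extend_by_diff_pattern w i j n : i < j -> j + n <= size w ->
  extend_by i (diff_pattern w i j n) (take j w) = take (j + n) w.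
Proof.
elim: n i j => [|n IHn] i j ij jw /=; first by rewrite addn0.
rewrite nth_take // addKb -take_nth; last by lia.
by rewrite IHn ?addSnnS //; lia.
Qed.

Fixpoint low_weight_words n d : seq (seq bool) :=
  match n, d with
  | _, 0 => [::]
  | 0, _.+1 => [:: [::]]
  | n'.+1, d'.+1 => [seq false :: e | e <- low_weight_words n' d]
                    ++ [seq true :: e | e <- low_weight_words n' d']
  end.

Lemma mem_low_weight_words n d e :
  size e = n -> count id e < d -> e \in low_weight_words n d.
Proof.
elim: n d e => [|n IHn] [|d] [|b e] //= [sz] wt.
rewrite mem_cat; case: b wt => wt.
- by apply/orP; right; apply: map_f; apply: IHn.
- by apply/orP; left; apply: map_f; apply: IHn.
Qed.

(** Pascal's recursion, with [n.+1 ^ d.+1 + n.+1 ^ d = n.+2 * n.+1 ^ d <= n.+2 ^ d.+1]. *)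
Lemma size_low_weight_words n d : size (low_weight_words n d) <= n.+1 ^ d.
Proof.
elim: n d => [|n IHn] [|d] //=; first by rewrite exp1n.
rewrite size_cat !size_map (leq_trans (leq_add (IHn _) (IHn _))) //.
rewrite expnS -mulSnr expnS leq_mul2l /=.
by rewrite leq_exp2rW.
Qed.

(** * Robust words, grown one bit at a time *)

Variables n d : nat.

(** Pairs ending earlier are tested when the word is shorter; words too short for a window pass. *)
Definition last_window_far w : bool :=
  (n <= size w) ==>
  all (fun i => d <= count id (diff_pattern w i (size w - n) n))
      (iota 0 (size w - n)).

Definition one_bit_extensions (l : seq (seq bool)) : seq (seq bool) :=
  [seq rcons w b | w <- l, b <- [:: false; true]].

Fixpoint robust_words k : seq (seq bool) :=
  if k is k'.+1 then [seq w <- one_bit_extensions (robust_words k') | last_window_far w]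
  else [:: [::]].

Lemma mem_one_bit_extensions l w : w \in one_bit_extensions l ->
  exists2 p, p \in l & exists b, w = rcons p b.
Proof. by case/allpairsP=> -[p b] /= [pl _ ->]; exists p => //; exists b. Qed.

Lemma uniq_one_bit_extensions l : uniq l -> uniq (one_bit_extensions l).
Proof.
move=> ul; apply: allpairs_uniq => // -[p b] [q c] _ _ /= /eqP.
by rewrite eqseq_rcons => /andP[/eqP-> /eqP->].
Qed.

Lemma uniq_robust_words k : uniq (robust_words k).
Proof. by elim: k => //= k IHk; rewrite filter_uniq ?uniq_one_bit_extensions. Qed.

Lemma size_mem_robust_words k w : w \in robust_words k -> size w = k.
Proof.
elim: k w => [|k IHk] w /=; first by rewrite inE => /eqP->.
rewrite mem_filter => /andP[_ /mem_one_bit_extensions[p /IHk pk [b ->]]].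
by rewrite size_rcons pk.
Qed.

Lemma take_robust_words m k w :
  w \in robust_words (m + k) -> take m w \in robust_words m.
Proof.
elim: k w => [|k IHk] w.
  by rewrite addn0 => wm; rewrite take_oversize // (size_mem_robust_words wm).
rewrite addnS /= mem_filter => /andP[_ /mem_one_bit_extensions[p pm [b ->]]].
rewrite -cats1 takel_cat ?IHk // (size_mem_robust_words pm); exact: leq_addr.
Qed.

(** Cut [w] at the end of the later window: the prefix is again robust, and its last window was
    tested against all earlier ones. *)
Lemma robust_wordsP k w i j : w \in robust_words k -> i < j -> j + n <= k ->
  d <= count id (diff_pattern w i j n).
Proof.
move=> wk ij jk.
have := wk; rewrite -(subnKC jk) => /take_robust_words.
have wjn : size (take (j + n) w) = j + n.
  by rewrite size_takel // (size_mem_robust_words wk).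
have -> : diff_pattern w i j n = diff_pattern (take (j + n) w) i j n.
  rewrite !diff_patternE; apply/eq_in_map => t; rewrite mem_iota => /andP[_ tn].
  by rewrite !nth_take //; lia.
case jn : (j + n) => [|q]; first by lia.
rewrite /= -jn mem_filter => /andP[+ _].
rewrite /last_window_far wjn leq_addl addnK => /allP; apply.
by rewrite mem_iota.
Qed.

Lemma size_robust_wordsS k : k.+1 < n ->
  size (robust_words k.+1) = 2 * size (robust_words k).
Proof.
move=> kn /=; rewrite (@eq_in_filter _ _ predT).
  by rewrite filter_predT size_allpairs mulnC.
move=> w /mem_one_bit_extensions[p /size_mem_robust_words pk [b ->]].
by rewrite /last_window_far size_rcons pk leqNgt kn.
Qed.

(** * Rosenfeld's counting argument *)

Hypothesis n_gt0 : 0 < n.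

Lemma size_robust_words_rec m k : m + n = k.+1 ->
  2 * size (robust_words k) <=
  size (robust_words k.+1) + m * n.+1 ^ d * size (robust_words m).
Proof.
move=> mnk.
set E := one_bit_extensions (robust_words k).
have szE : size E = 2 * size (robust_words k) by rewrite size_allpairs mulnC.
rewrite -szE -(count_predC last_window_far) -size_filter leq_add2l -size_filter.
pose codes := [seq (i, e) | i <- iota 0 m, e <- low_weight_words n d].
(* The bad words are listed without repetition and each is decoded from a code and its first [m]
   bits, so there are at most as many as such pairs. *)
apply: (@leq_trans (size [seq extend_by c.1 c.2 p | c <- codes, p <- robust_words m])).
  apply: uniq_leq_size.
    by rewrite filter_uniq // uniq_one_bit_extensions // uniq_robust_words.
  move=> w; rewrite mem_filter => /andP[/= bad wE].
  have [p pk [b wE']] := mem_one_bit_extensions wE.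
  have szp := size_mem_robust_words pk.
  have szw : size w = m + n by rewrite wE' size_rcons szp mnk.
  move: bad; rewrite /last_window_far szw leq_addl addnK /=.
  case/allPn => i; rewrite mem_iota add0n => /andP[_ im]; rewrite -ltnNge => wt.
  have wm : take m w \in robust_words m.
    rewrite wE' -cats1 takel_cat; last by rewrite szp; lia.
    by apply: (@take_robust_words m n.-1); have -> : m + n.-1 = k by lia.
  apply/allpairsP; exists ((i, diff_pattern w i m n), take m w); split => //=.
  - apply/allpairsP; exists (i, diff_pattern w i m n); split => //=.
      by rewrite mem_iota.
    by apply: mem_low_weight_words wt; rewrite diff_patternE size_mkseq.
  - by rewrite extend_by_diff_pattern ?szw // take_oversize ?szw.
rewrite !size_allpairs size_iota leq_mul2r; apply/orP; right.
by rewrite leq_mul2l size_low_weight_words orbT.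
Qed.

Variable L : nat.
Hypothesis L_small : 4 * L * n * n.+1 ^ d <= 2 ^ n.

(** Growth by the factor [2 - 1/n], with denominators cleared to stay in the naturals. *)
Lemma robust_words_growth k : k < L ->
  (2 * n).-1 * size (robust_words k) <= n * size (robust_words k.+1).
Proof.
elim/ltn_ind: k => k IHk kL.
have [kn|nk] := ltnP k.+1 n; first by rewrite size_robust_wordsS //; nia.
pose m := k.+1 - n; have mnk : m + n = k.+1 by rewrite subnK.
(* Bernoulli's inequality: [t] growth steps give the factor [2 ^ t * (1 - 1/(2n)) ^ t >= 2 ^ t * (1
   - t/(2n))]. *)
have Tmk t : t < n ->
    2 ^ t * (2 * n - t) * size (robust_words m) <=
    2 * n * size (robust_words (m + t)).
  elim: t => [|t IHt] tn; first by rewrite addn0 mul1n subn0.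
  have := IHk (m + t) ltac:(lia) ltac:(lia); rewrite -addnS.
  have := IHt (ltnW tn); rewrite expnS.
  move: (size _) (size _) (size _) (2 ^ t) => T T1 T2 x H1 H2.
  rewrite -(@leq_pmul2l (2 * n)); last by lia.
  have H3 : 2 * n * (2 * n - t.+1) * (2 * (x * T)) <=
            (2 * n).-1 * (2 * n - t) * (2 * (x * T)) by rewrite leq_mul2r; nia.
  have H4 := leq_mul (leqnn (2 * (2 * n).-1)) H1.
  have H5 := leq_mul (leqnn (4 * n)) H2.
  lia.
have := Tmk n.-1 ltac:(lia).
have -> : m + n.-1 = k by lia.
have -> : 2 * n - n.-1 = n.+1 by lia.
have := size_robust_words_rec mnk; have := L_small.
have -> : 2 ^ n = 2 * 2 ^ n.-1 by rewrite -expnS prednK.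
move: (size _) (size _) (size _) (2 ^ _) (n.+1 ^ d) => Tm T1 T0 x V HL H1 H2.
have xT : x * Tm <= 2 * T0 by rewrite -(leq_pmul2l n_gt0); nia.
(* With [xT], the loss [m * V * Tm] is at most [T0 / n]. *)
have mxT : 2 * m * n * V * Tm <= x * Tm.
  rewrite leq_mul2r; apply/orP; right.
  have mL : m <= L by lia.
  have := leq_mul (leqnn (2 * n * V)) mL; lia.
have := leq_mul (leqnn n) H1; lia.
Qed.

Lemma robust_words_gt0 k : k <= L -> 0 < size (robust_words k).
Proof.
elim: k => // k IHk kL.
have := robust_words_growth kL; have := IHk (ltnW kL); nia.
Qed.

End Words.

(** * From words to arrays *)

Lemma robust_word_exists n d L : 0 < n -> 4 * L * n * n.+1 ^ d <= 2 ^ n ->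
  exists w : seq bool, forall i j, i < j -> j + n <= L ->
    d <= count id (diff_pattern w i j n).
Proof.
move=> n_gt0 Ln; have := robust_words_gt0 n_gt0 Ln (leqnn L).
case E : (robust_words n d L) => [//|w l] _; exists w => i j.
by apply: robust_wordsP; rewrite E mem_head.
Qed.

(** Columns are consecutive blocks of [n1] bits, so the full-height window at column [j] is the
    factor of [w] starting at [j * n1]. *)
Definition array_of_word (w : seq bool) n1 N2 : 'M[bool]_(n1, N2) :=
  \matrix_(a, b) nth false w (b * n1 + a).

Lemma hamming_dist_sym (T : eqType) m n (P Q : 'M[T]_(m, n)) :
  hamming_dist P Q = hamming_dist Q P.
Proof. by apply: eq_card => ab; rewrite !inE eq_sym. Qed.

Lemma hamming_dist_array_of_word w n1 n2 N2 j j' (h h' : 0 + n1 <= n1)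
    (hj : j + n2 <= N2) (hj' : j' + n2 <= N2) :
  count id (diff_pattern w (j * n1) (j' * n1) (n1 * n2)) <=
  hamming_dist (subarray (array_of_word w n1 N2) h hj)
               (subarray (array_of_word w n1 N2) h' hj').
Proof.
case: (posnP n1) => [n10|n1_gt0]; first by have -> : n1 * n2 = 0 by rewrite n10.
rewrite diff_patternE count_map -(val_enum_ord (n1 * n2)) count_map.
have ra (t : 'I_(n1 * n2)) : t %% n1 < n1 by rewrite ltn_mod.
have rb (t : 'I_(n1 * n2)) : t %/ n1 < n2 by rewrite ltn_divLR // (mulnC n2) ltn_ord.
pose f t : 'I_n1 * 'I_n2 := (Ordinal (ra t), Ordinal (rb t)).
have f_inj : injective f.
  move=> s t [e1 e2]; apply: val_inj.
  by rewrite /= (divn_eq s n1) (divn_eq t n1) e1 e2.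
set P := (P in count P _).
have -> : count P (enum 'I_(n1 * n2)) = #|P| by rewrite cardE size_filter enumT.
rewrite -(card_imset P f_inj).
apply/subset_leq_card/fintype.subsetP => ab /imsetP[t ht ->].
rewrite !inE !mxE /= !add0n.
have E q : (q + t %/ n1) * n1 + t %% n1 = q * n1 + t.
  by rewrite mulnDl -addnA -divn_eq.
by rewrite !E; move: ht; rewrite inE /P /=; do 2 case: nth.
Qed.

Lemma robust_array_exists n1 n2 d N2 : 0 < n1 -> 0 < n2 -> n2 <= N2 ->
  4 * (n1 * N2) * (n1 * n2) * (n1 * n2).+1 ^ d <= 2 ^ (n1 * n2) ->
  exists M : 'M[bool]_(n1, N2), robust_positioning_array n1 n2 d M.
Proof.
move=> n1_gt0 n2_gt0 n2N /robust_word_exists[|w w_far]; first by rewrite muln_gt0 n1_gt0.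
have far j j' : j < j' -> j' + n2 <= N2 ->
    d <= count id (diff_pattern w (j * n1) (j' * n1) (n1 * n2)).
  by move=> jj' j'N; apply: w_far; nia.
exists (array_of_word w n1 N2); split=> // i j i' j' hi hj hi' hj' ne.
(* With only [n1] rows, all windows start in row 0. *)
have [i0 i'0] : i = 0 /\ i' = 0 by lia.
subst i i'; have [jj'|j'j|jj'] := ltngtP j j'; last by rewrite jj' in ne.
- exact: leq_trans (far _ _ jj' hj') (hamming_dist_array_of_word _ _ _ _ _).
- rewrite hamming_dist_sym.
  exact: leq_trans (far _ _ j'j hj) (hamming_dist_array_of_word _ _ _ _ _).
Qed.

Local Open Scope ring_scope.

Theorem corollary4p5 (R : realType) (d : nat) (hd : (1 <= d)%N) (c : R) :
  exists (eps : nat -> R) (A0 : nat),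
    eps n @[n --> \oo] --> (0 : R) /\
    forall n1 n2 : nat,
      (1 <= n1)%N -> (n1 <= n2)%N -> thickness R n1 n2 <= c ->
      (A0 <= n1 * n2)%N ->
      exists (N1 N2 : nat) (M : 'M[bool]_(N1, N2)),
        robust_positioning_array n1 n2 d M /\
        redundancy R n1 n2 N1 N2 <=
          421 / 100 * d%:R * log2 ((n1 * n2)%:R : R)
          + 3689 / 100 * log2 ((n1 * n2)%:R : R)
          + eps (n1 * n2)%N.
Proof.
(* The exponent in [n2 * D <= A ^ k], which makes [N2] at least [n2]: [4 <= A ^ 3],
   [A.+1 ^ d <= A ^ (2 * d)] and [n1 * n2 * A = A ^ 2]. *)
pose k := (2 * d + 5)%N.
exists (fun=> 0), (2 ^ k.*2.+1)%N; split; first exact: cvg_cst.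
move=> n1 n2 n1_gt0 n12 _ AA.
have n2_gt0 := leq_trans n1_gt0 n12.
set A := (n1 * n2)%N in AA *.
have A_ge2 : (2 <= A)%N.
  by apply: leq_trans AA; rewrite -{1}[2%N]expn1 leq_exp2l.
have A1d : (A.+1 ^ d <= A ^ (2 * d))%N.
  by rewrite expnM leq_exp2rW // -mulnn; nia.
have A8 : (8 <= A ^ 3)%N by rewrite -[8%N]/(2 ^ 3)%N leq_exp2r.
pose D := (4 * A * A.+1 ^ d * n1)%N.
have D_gt0 : (0 < D)%N by rewrite !muln_gt0 expn_gt0; lia.
pose N2 := (2 ^ A %/ D)%N.
have n2N : (n2 <= N2)%N.
  rewrite leq_divRL //; apply: leq_trans (exp_le_exp2 AA).
  have -> : (n2 * D = 4 * A.+1 ^ d * A ^ 2)%N by rewrite /D /A; nia.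
  rewrite (@leq_trans (A ^ 3 * A ^ (2 * d) * A ^ 2)) //.
    by rewrite leq_mul2r leq_mul ?orbT //; lia.
  by rewrite -!expnD leq_exp2l //; lia.
have [|M hM] := @robust_array_exists n1 n2 d N2 n1_gt0 n2_gt0 n2N.
  rewrite -/A; apply: leq_trans (leq_divM (2 ^ A) D); rewrite -/N2 /D; nia.
exists n1, N2, M; split=> //; rewrite addr0.
(* Rounding down in [N2] costs at most a factor 2, since [N2.+1 <= 2 * N2]; this turns the 4 of [D]
   into [8 <= A ^ 3]. *)
have size_bound : (2 ^ A <= n1 * N2 * A ^ (2 * d + 4))%N.
  have := ltn_ceil (2 ^ A) D_gt0; rewrite -/N2 => /ltnW/leq_trans; apply.
  apply: (@leq_trans (2 * N2 * D)); first by rewrite leq_mul2r; lia.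
  have -> : (2 * N2 * D = n1 * N2 * (8 * A.+1 ^ d * A))%N by rewrite /D; nia.
  have -> : (2 * d + 4 = 3 + 2 * d + 1)%N by lia.
  by rewrite (expnD _ _ 1) (expnD _ 3) expn1 leq_mul2l leq_mul2r leq_mul ?orbT.
have L_gt0 : (0 < n1 * N2)%N by rewrite muln_gt0; lia.
have ln2_gt0 : 0 < ln 2 :> R by rewrite ln_gt0 ?ltr1n.
have log_bound : A%:R - log2 (n1 * N2)%:R <= (2 * d + 4)%:R * log2 (A%:R : R).
  rewrite lerBlDl /log2 mulrA -mulrDl ler_pdivlMr //.
  have := size_bound.
  rewrite -(ler_nat R) -ler_ln ?posrE ?ltr0n ?muln_gt0 ?expn_gt0 //; last first.
    by lia.
  rewrite natrX natrM natrX lnM ?posrE ?ltr0n ?exprn_gt0 ?ltr0n //; last by lia.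
  by rewrite !lnXn ?ltr0n ?mulr_natl //; apply: ltnW.
apply: le_trans log_bound _; rewrite -mulrDl ler_wpM2r //.
  by rewrite divr_ge0 ?ln_ge0 ?ler1n ?(ltW ln2_gt0) // ltnW.
(* [2 d + 4 <= 4.21 d + 36.89]. *)
by have := ler0n R d; rewrite natrD natrM; lra.
Qed.
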